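(* Let $S \subseteq \omega_1$ be a stationary set consisting of (nonzero) limit ordinals, let $G_{\omega_1}$ be any $T$-graph on the order tree $T$ of all sequences of elements of $\omega_1$ of length $\leq \omega$, let $F(S)=\{f_s : s\in S\}$ be any choice of cofinal sequences $f_s\colon \mathbb{N}\to s$ ($s \in S$), and let $G_{\omega_1}(S)$ be the corresponding induced subgraph of $G_{\omega_1}$. Then $G_{\omega_1}(S)$ does not have a normal spanning tree, and $G_{\omega_1}(S)$ contains neither an $(\aleph_0,\aleph_1)$-graph nor an Aronszajn-tree graph as a minor.
   Context: Normal spanning trees: for a graph-theoretic tree $R$ with root $r$, write $x\le y$ if $x$ lies on the unique $r$--$y$ path in $R$. A rooted spanning tree $R$ of a graph $G$ is normal if the ends of every edge of $G$ are comparable in this order. Minors: a graph $H$ is a minor of $G$ if to every vertex $x$ of $H$ one can assign a (possibly infinite) nonempty connected set $V_x\subseteq V(G)$ such that the sets $V_x$ are pairwise disjoint and $G$ contains a $V_x$--$V_y$ edge whenever $xy$ is an edge of $H$. Order trees: an order tree is a partially ordered set $(T,\le)$ with a unique minimal element (the root) in which every set $\lceil t\rceil=\{t'\in T: t'\le t\}$ is well-ordered; put $\mathring{\lceil t\rceil}=\lceil t\rceil\setminus\{t\}$. A branch is a maximal chain. The $i$th level $T^i$ is the set of all $t\in T$ such that $\mathring{\lceil t\rceil}$ has order type $i$. $T$-graphs: given an order tree $T$, a graph $G$ is a $T$-graph if $V(G)=T$, the two ends of every edge of $G$ are comparable in $T$, and for every $t\in T$ the set of neighbours of $t$ that lie below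 $t$ is cofinal in $\mathring{\lceil t\rceil}$. The graphs $G_{\omega_1}(S)$: let $T$ be the order tree whose nodes are all sequences of elements of $\omega_1$ of length $\le\omega$ (including the empty sequence), with $t\le t'$ iff $t$ is an initial segment of $t'$. Let $G_{\omega_1}$ be any $T$-graph. Given a set $S\subseteq\omega_1$ of limit ordinals, choose for each $s\in S$ a cofinal (not necessarily increasing) sequence $f_s\colon\mathbb{N}\to s$, regarded as a node of $T$ of height $\omega$, and let $F(S)=\{f_s:s\in S\}$. Let $T(S)$ be the subtree of $T$ consisting of all finite sequences in $T$ together with $F(S)$, and let $G_{\omega_1}(S)$ be the subgraph of $G_{\omega_1}$ induced by $T(S)$. An $(\aleph_0,\aleph_1)$-graph is a bipartite graph with bipartition $(A,B)$ such that $|A|=\aleph_0$, $|B|=\aleph_1$, and every vertex in $B$ has infinite degree. An Aronszajn tree is an order tree of size $\aleph_1$ in which all levels and all branches are countable. An Aronszajn-tree graph is a graph whose vertex set is an Aronszajn tree $\mathcal{T}$ such that for every node $t\in\mathcal{T}$ the set of neighbours of $t$ below $t$ is cofinal below $t$. A subset of $\omega_1$ is stationary if it meets every closed unbounded subset of $\omega_1$. *)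

(* Defs.v *)
From Stdlib Require List.
From HB Require Import structures.
From mathcomp Require Import all_boot all_order.
From mathcomp Require Import boolp classical_sets functions cardinality wochoice.

Set Implicit Arguments.
Unset Strict Implicit.
Unset Printing Implicit Defensive.

Import Order.TTheory.

Local Open Scope order_scope.
Local Open Scope classical_set_scope.
Local Open Scope card_scope.

Record graph (V : Type) := Graph {
  adj :> V -> V -> Prop;
  adj_sym : forall x y, adj x y -> adj y x;
  adj_irr : forall x, ~ adj x x
}.

Section Graphs.
Context {V : Type}.
Implicit Types (G R : graph V) (A : set V).

Lemma induced_sym G A (x y : A) : G (\val x) (\val y) -> G (\val y) (\val x).
Proof. exact: adj_sym. Qed.

Lemma induced_irr G A (x : A) : ~ G (\val x) (\val x).
Proof. exact: adj_irr. Qed.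

Definition induced G A : graph A := Graph (@induced_sym G A) (@induced_irr G A).

(* As for [path] in MathComp, the vertices of a walk or path from [x] to [y]  *)
(* are those of [x :: p].                                                     *)
Fixpoint walk G (x : V) (p : seq V) (y : V) : Prop :=
  if p is z :: q then G x z /\ walk G z q y else x = y.

Definition is_path G (x : V) (p : seq V) (y : V) : Prop :=
  walk G x p y /\ List.NoDup (x :: p).

Definition connected_set G A : Prop :=
  forall x y, A x -> A y ->
    exists2 p, is_path G x p y & forall z, List.In z (x :: p) -> A z.

(* A cycle is a path with at least three vertices and adjacent ends.          *)
Definition acyclic G : Prop :=
  forall x p y, is_path G x p y -> (2 <= size p)%N -> ~ G y x.

Definition graph_tree R : Prop := connected_set R setT /\ acyclic R.

Definition tree_le R (r x y : V) : Prop :=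
  exists2 p, is_path R r p y & List.In x (r :: p).

Definition normal_spanning_tree G R (r : V) : Prop :=
  [/\ graph_tree R,
      forall x y, R x y -> G x y &
      forall x y, G x y -> tree_le R r x y \/ tree_le R r y x].

Definition has_normal_spanning_tree G : Prop :=
  exists R r, normal_spanning_tree G R r.

Definition infinite_degree G (x : V) : Prop := infinite_set [set y | G x y].

End Graphs.

Definition minor (U V : Type) (H : graph U) (G : graph V) : Prop :=
  exists B : U -> set V,
    [/\ forall x, B x !=set0 /\ connected_set G (B x),
        trivIset [set: U] B &
        forall x y, H x y -> exists u v, [/\ B x u, B y v & G u v]].

Definition cofinal d (T : porderType d) (X A : set T) : Prop :=
  X `<=` A /\ forall a, A a -> exists2 x, X x & a <= x.

Section OrderTrees.
Context d (T : porderType d).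

Definition order_tree : Prop :=
  (exists! r : T, minimal <=%O r) /\ (forall t : T, wo_chain <=%O (<= t)).

Definition below (t : T) : set T := [set x | x < t].

(* Ordinals are represented by well-ordered types: this is the level of [T]   *)
(* indexed by the order type of [I].                                          *)
Definition level di (I : orderType di) : set T :=
  [set t | exists2 g : I -> T, {mono g : i j / i <= j} & range g = below t].

Definition is_chain (A : set T) : Prop := total_on A (fun x y => x <= y).

Definition branch (A : set T) : Prop :=
  is_chain A /\ forall B, is_chain B -> A `<=` B -> B = A.

Definition cofinal_lower_neighbours (G : graph T) : Prop :=
  forall t, cofinal [set u | G t u /\ u < t] (below t).

Definition T_graph (G : graph T) : Prop :=
  (forall x y, G x y -> x >=< y) /\ cofinal_lower_neighbours G.

End OrderTrees.

Arguments order_tree {d} T.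
Arguments level {d} T {di} I.

(* Characterizes the order type omega_1 (for total orders, up to isomorphism).*)
Definition is_omega1 d (W : orderType d) : Prop :=
  [/\ well_order (<=%O : rel W), ~ countable [set: W] &
      forall w : W, countable [set v | v < w]].

Section Omega1.
Context d (W : orderType d).

(* As [0] is not a limit, a limit ordinal has a smaller element.              *)
Definition limit_ordinal (s : W) : Prop :=
  (exists v, v < s) /\ forall v, v < s -> exists2 u, v < u & u < s.

Definition unbounded (C : set W) : Prop := forall w, exists2 c, C c & w <= c.

Definition closed_in_order (C : set W) : Prop :=
  forall s, limit_ordinal s ->
    cofinal (C `&` [set v | v < s]) [set v | v < s] -> C s.

Definition club (C : set W) : Prop := closed_in_order C /\ unbounded C.

Definition stationary (S : set W) : Prop :=
  forall C, club C -> S `&` C !=set0.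

(* In the next two definitions [W] plays the role of omega_1, so that         *)
(* [#= [set: W]] means being of cardinality aleph_1.                          *)
Definition aleph0_aleph1_graph (V : Type) (H : graph V) : Prop :=
  exists A B : set V,
    [/\ A `|` B = setT /\ A `&` B = set0,
        forall x y, H x y -> (A x /\ B y) \/ (B x /\ A y),
        A #= [set: nat],
        B #= [set: W] &
        forall b, B b -> infinite_degree H b].

Definition aronszajn_tree dT (T : porderType dT) : Prop :=
  [/\ order_tree T,
      [set: T] #= [set: W],
      forall di (I : orderType di), well_order (<=%O : rel I) ->
        countable (level T I) &
      forall A : set T, branch A -> countable A].

Definition aronszajn_tree_graph dT (T : porderType dT) (H : graph T) : Prop :=
  aronszajn_tree T /\ cofinal_lower_neighbours H.

End Omega1.

Inductive sequence (X : Type) := Fin of seq X | Inf of nat -> X.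
Arguments Fin {X}.
Arguments Inf {X}.

HB.instance Definition _ (X : Type) := gen_eqMixin (sequence X).
HB.instance Definition _ (X : Type) := gen_choiceMixin (sequence X).

Section SequenceTree.
Context {X : eqType}.
Implicit Types (t u : sequence X).

Definition initial_segment t u : bool :=
  match t, u with
  | Fin s, Fin s' => prefix s s'
  | Fin s, Inf f => s == mkseq f (size s)
  | Inf _, Fin _ => false
  | Inf f, Inf g => f == g
  end.

Lemma initial_segment_refl : reflexive initial_segment.
Proof. by case=> [s|f] /=; rewrite ?prefix_refl. Qed.

Lemma initial_segment_anti : antisymmetric initial_segment.
Proof.
case=> [s|f] [s'|g] // /andP[] //=; last by move=> /eqP ->.
move=> /prefixP[u ->] /prefixP[v] /(congr1 size)/eqP.
rewrite !size_cat -addnA -{1}[size s]addn0 eqn_add2l eq_sym addn_eq0.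
by case/andP; rewrite size_eq0 => /eqP ->; rewrite cats0.
Qed.

Lemma initial_segment_trans : transitive initial_segment.
Proof.
case=> [t|g] [s|f] [u|h] //=; first exact: prefix_trans.
- move=> /prefixP[v ->] /eqP; rewrite size_cat /mkseq iotaD map_cat.
  by move/eqP; rewrite eqseq_cat ?size_map ?size_iota // => /andP[].
- by move=> sg /eqP <-.
- by move=> /eqP -> /eqP ->.
Qed.

End SequenceTree.

Fact sequence_display : Order.disp_t. Proof. exact: Order.Disp tt tt. Qed.

HB.instance Definition _ (X : eqType) :=
  Order.Le_isPOrder.Build sequence_display (sequence X)
    (@initial_segment_refl X) (@initial_segment_anti X)
    (@initial_segment_trans X).

Lemma le_sequence (X : eqType) (t u : sequence X) :
  (t <= u) = initial_segment t u.
Proof. by []. Qed.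

Lemma sequence_chain (X : eqType) (t x y : sequence X) :
  x <= t -> y <= t -> (x <= y) || (y <= x).
Proof.
rewrite !le_sequence; case: x y t => [s|f] [s'|g] [u|h] //=.
- rewrite !prefixE => /eqP us /eqP us'; have := leq_total (size s) (size s').
  case/orP=> le; apply/orP; [left|right].
    by rewrite -[X in take _ X]us' take_takel // us.
  by rewrite -[X in take _ X]us take_takel // us'.
- have pre i j : (i <= j)%N -> prefix (mkseq h i) (mkseq h j).
    move=> ij; apply/prefixP; exists (map h (iota i (j - i))).
    by rewrite /mkseq -map_cat -[X in _ ++ iota X _]add0n -iotaD subnKC.
  move=> /eqP -> /eqP ->; have := leq_total (size s) (size s').
  by case/orP=> /pre ->; rewrite ?orbT.
- by move=> sh /eqP ->; rewrite sh.
- by move=> /eqP -> ->.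
- by move=> /eqP -> /eqP ->; rewrite eqxx.
Qed.

Lemma sequence_order_tree (X : eqType) : order_tree (sequence X).
Proof.
have min0 (t : sequence X) : Fin [::] <= t.
  by rewrite le_sequence; case: t => [s|g] /=; rewrite ?prefix0s.
split.
  exists (Fin [::]); split=> [x _|t /(_ _ (min0 t)) t0]; first exact: min0.
  by apply: le_anti; rewrite min0.
move=> t; apply: antisymmetric_wo_chain; first by move=> x y _ _ /le_anti.
move=> A At [a Aa].
have tot x y : x \in A -> y \in A -> (x <= y) || (y <= x).
  by move=> /At xt /At yt; exact: sequence_chain xt yt.
pose P n := `[< exists2 s, Fin s \in A & size s = n >].
have [exP|noF] := pselect (exists n, P n).
  have [m /asboolP[s As <-] minm] := ex_minnP exP.
  exists (Fin s); split=> // x Ax.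
  case/orP: (tot _ _ As Ax) => //; case: x Ax => [s' As'|//].
  rewrite !le_sequence /= prefixE => /eqP ss'.
  have /minm : P (size s').
    by apply/asboolP; exists s'.
  by move=> /take_oversize; rewrite ss' => ->; exact: prefix_refl.
exists a; split=> // x Ax.
have inf y : y \in A -> exists g, y = Inf g.
  case: y => [s As|g _]; last by exists g.
  by case: noF; exists (size s); apply/asboolP; exists s.
case/orP: (tot _ _ Aa Ax) => //.
have [[g ->] [h ->]] := (inf _ Aa, inf _ Ax).
by rewrite !le_sequence /= eq_sym.
Qed.

(* [T(S)]: all finite sequences, and the sequences [f s] for [s] in [S].      *)
Definition subtree_on d (W : orderType d) (S : set W) (f : W -> nat -> W) :
    set (sequence W) :=
  range Fin `|` [set Inf (f s) | s in S].

(* Main.v *)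
Require Import Defs.
From Stdlib Require List.
From HB Require Import structures.
From mathcomp Require Import all_boot all_order.
From mathcomp Require Import boolp classical_sets functions cardinality wochoice.

(* Filter the vertices by stages: stage [w] consists of the finite sequences  *)
(* with entries below [w] and of the [f s] with [s < w]. Stages are countable *)
(* and continuous, so closing them off under a countable-valued function      *)
(* leaves a club of closed stages. If a vertex [x] outside stage [w] is       *)
(* comparable to infinitely many vertices in stage [w], then [w] is in [S]    *)
(* and [x] is [f w].                                                          *)
(*   Normal spanning tree: pick [s] in [S] whose stage is down-closed in the  *)
(* tree. The vertex [f s] has infinitely many neighbours in stage [s]; none   *)
(* of them lies above [f s] in the tree, yet only finitely many lie below.    *)
(*   Minors: a connected set of vertices has a minimum in the sequence tree,  *)
(* so a minor yields an injection [m] into the vertices with comparable       *)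
(* images of adjacent vertices. If stage [w] contains [m A] with [A]          *)
(* countable, every vertex of infinite degree into [A] is mapped to stage [w] *)
(* or to [f w]. For an Aronszajn tree and [w] in a suitable club, the nodes   *)
(* mapped outside stage [w] have a unique minimal element, since [m] maps any *)
(* minimal one to [f w]; as [w] varies these form an uncountable chain.       *)

Set Implicit Arguments.
Unset Strict Implicit.
Unset Printing Implicit Defensive.

Import Order.TTheory.

Local Open Scope order_scope.
Local Open Scope classical_set_scope.
Local Open Scope card_scope.

(** By [filtration_stage] and [club_closed_under] the closed stages have a club of indices.
    Stationarity gives one at some [s] in [S], where the infinitely many lower neighbours of [f s]
    contradict [finite_tree_le]. Both minor arguments pass from [minor_comparable_injection] to
    [stage_frontier]: outside a stage only one vertex can be infinitely attached to it. This makes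
    [B] countable, and turns the exits of an Aronszajn tree from closed stages into the chain of
    [first_outside_chain]. *)

(** * Walks and unique paths in acyclic graphs *)

Section Walks.
Context {V : Type} (G : graph V).
Implicit Types (x y z : V) (p q : seq V).

Lemma In_cat_or x p q : List.In x (p ++ q) -> List.In x p \/ List.In x q.
Proof. exact: List.in_app_or. Qed.

Lemma walk_cat x p y q z : walk G x p y -> walk G y q z -> walk G x (p ++ q) z.
Proof.
elim: p x => [|a p IHp] x /=; first by move=> ->.
by case=> xa /IHp ap /ap.
Qed.

Lemma walk_last x p y : walk G x p y -> List.In y (x :: p).
Proof.
by elim: p x => [|a p IHp] x /=; [left|case=> _ /IHp; right].
Qed.

Lemma walk_rev x p y : walk G x p y ->
  exists2 q, walk G y q x & List.incl (y :: q) (x :: p).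
Proof.
elim: p x => [|a p IHp] x /=.
  by move=> ->; exists [::] => //; exact: List.incl_refl.
case=> xa /IHp[q yqa qp]; exists (q ++ [:: x]).
  by apply: (walk_cat yqa) => /=; split=> //; apply: adj_sym.
move=> z; rewrite -cat_cons => /In_cat_or[/qp|[<-|[]]]; first by right.
by left.
Qed.

Lemma path_suffix x p y z : is_path G x p y -> List.In z (x :: p) ->
  exists2 q, is_path G z q y & List.incl (z :: q) (x :: p).
Proof.
elim: p x => [|a p IHp] x xp.
  by case=> [<-|[]]; exists [::] => //; apply: List.incl_refl.
case=> [<-|]; first by exists (a :: p) => //; apply: List.incl_refl.
case: xp => -[_ ap] /List.NoDup_cons_iff[_ nd] zp.
have [//|q zq qp] := IHp a _ zp.
by exists q => //; apply: List.incl_tl.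
Qed.

Lemma walk_path x p y : walk G x p y ->
  exists2 q, is_path G x q y & List.incl (x :: q) (x :: p).
Proof.
elim: p x => [|a p IHp] x /=.
  move=> ->; exists [::]; last exact: List.incl_refl.
  by split=> //; apply/List.NoDup_cons => //; apply: List.NoDup_nil.
case=> xa /IHp[q aq qp].
have [xq|xq] := pselect (List.In x (a :: q)).
  have [q' xq' q'q] := path_suffix aq xq; exists q' => //.
  by apply: List.incl_tl; apply: List.incl_tran q'q qp.
exists (a :: q).
  by case: aq => aq nd; split=> //; apply/List.NoDup_cons.
by move=> z [<-|/qp]; [left|right].
Qed.

(** If the paths leave [x] by different neighbours [a] and [b], their remainders form a walk from
    [a] to [b] avoiding [x]; shortened to a path and closed up through [x], it is a cycle. *)
Lemma acyclic_path_uniq x p q y :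
  acyclic G -> is_path G x p y -> is_path G x q y -> p = q.
Proof.
move=> acG; elim: p x q => [|a p IHp] x [|b q]; first by [].
- by move=> [/= -> _] [[_ /walk_last yq] /List.NoDup_cons_iff[]].
- move=> [[_ /walk_last yp] /List.NoDup_cons_iff[nyp _]] [/= xy _].
  by case: nyp; rewrite xy.
move=> [[xa ap] /List.NoDup_cons_iff[xp ndp]].
move=> [[xb bq] /List.NoDup_cons_iff[xq ndq]].
have [ab|ab] := pselect (a = b).
  by move: ab bq xq ndq => <- bq _ ndq; rewrite (IHp a q).
have [q' yq' q'q] := walk_rev bq.
have [r [wr ndr] rpq] := walk_path (walk_cat ap yq').
exfalso; apply: (acG x (a :: r) b); last exact: adj_sym.
  split=> //; apply/List.NoDup_cons => // /rpq.
  rewrite -cat_cons => /In_cat_or[//|xq'].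
  by apply/xq/q'q; right.
(* [r] is nonempty because [a] differs from [b]. *)
by case: r wr {ndr rpq}.
Qed.

Lemma finite_set_In (s : seq V) : finite_set [set x | List.In x s].
Proof.
elim: s => [|a s IHs]; first exact: finite_set0.
apply: sub_finite_set (_ : _ `<=` [set a] `|` [set x | List.In x s]) _.
  by move=> x [->|]; [left|right].
by rewrite finite_setU; split=> //; apply: finite_set1.
Qed.

Lemma finite_tree_le r y : acyclic G -> finite_set [set x | tree_le G r x y].
Proof.
move=> acG; have [[p rpy]|nop] := pselect (exists p, is_path G r p y).
  apply: sub_finite_set (finite_set_In (r :: p)) => x [q rqy].
  by rewrite (acyclic_path_uniq acG rqy rpy).
rewrite (_ : mkset _ = set0) // -subset0 => x [p rpy _].
by apply: nop; exists p.
Qed.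

End Walks.

(** * Order trees: minima, chains and levels *)

Section OrderTree.
Context d (T : porderType d).
Implicit Types (A X : set T) (x y t : T).

Lemma order_tree_total x y t :
  order_tree T -> x <= t -> y <= t -> (x <= y) || (y <= x).
Proof. by case=> _ /(_ t)/wo_chainW woT xt yt; apply: woT. Qed.

Lemma order_tree_min A x : order_tree T -> A x ->
  exists2 m, A m /\ m <= x & forall y, A y -> y <= x -> m <= y.
Proof.
case=> _ /(_ x) woT Ax.
case: (woT (fun y => `[< A y /\ y <= x >])); first by move=> y /asboolP[].
  by exists x; apply/asboolP.
move=> m [[/asboolP mA minm] _]; exists m => // y Ay yx.
by apply: minm; apply/asboolP.
Qed.

Lemma infinite_cofinal X A : is_chain A -> A !=set0 ->
  (forall x, A x -> exists2 y, A y & x < y) -> cofinal X A -> infinite_set X.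
Proof.
move=> chA [a Aa] nomax [XA cofX] /finite_seqP[s Xs].
have [x xs maxx] : exists2 x, x \in s & forall y, y \in s -> y <= x.
  have sA x : x \in s -> A x by move=> xs; apply: XA; rewrite Xs.
  have [b bX _] := cofX a Aa.
  have : s != [::] by apply: contraPneq bX => s0; rewrite Xs s0.
  elim: s sA {Xs XA cofX bX} => // c s IHs sA _.
  have [->|s0] := eqVneq s [::].
    by exists c => [|y]; rewrite mem_seq1 // => /eqP ->.
  have sA' x : x \in s -> A x by move=> xs; apply: sA; rewrite inE xs orbT.
  have [x xs maxx] := IHs sA' s0.
  have [cx|xc] := chA c x (sA _ (mem_head _ _)) (sA' _ xs).
    exists x; first by rewrite inE xs orbT.
    by move=> y; rewrite inE => /predU1P[->|/maxx].
  exists c; rewrite ?mem_head // => y; rewrite inE => /predU1P[->//|/maxx yx].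
  exact: le_trans yx xc.
have /nomax[y Ay xy] : A x by apply: XA; rewrite Xs.
have [z zX yz] := cofX y Ay.
have zx : z <= x by apply: maxx; move: zX; rewrite Xs.
by have := lt_le_trans xy (le_trans yz zx); rewrite ltxx.
Qed.

(* Steps down along a walk can be bypassed, since the set below a vertex is a *)
(* chain.                                                                     *)
Lemma walk_lower_bound (U : Type) (G : graph U) (h : U -> T) (x y : U) p :
  order_tree T -> (forall u v, G u v -> h u >=< h v) -> walk G x p y ->
  exists2 z, List.In z (x :: p) & h z <= h x /\ h z <= h y.
Proof.
move=> otT compG; elim: p x => [|a p IHp] x /=.
  by move=> ->; exists y => //; left.
case=> /compG xa /IHp[z zp [za zy]].
have [xa'|ax] := orP xa.
  have [xz|zx] := orP (order_tree_total otT xa' za).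
    by exists x; [left|split=> //; apply: le_trans xz zy].
  by exists z; [right|].
by exists z; [right|split=> //; apply: le_trans za ax].
Qed.

(** A minimal image is least: by [walk_lower_bound], a path in [B] from it to any [x] meets a vertex
    with image below both ends. *)
Lemma connected_set_min (U : Type) (G : graph U) (h : U -> T) (B : set U) :
  order_tree T -> (forall u v, G u v -> h u >=< h v) ->
  B !=set0 -> connected_set G B ->
  exists2 m, B m & forall u, B u -> h m <= h u.
Proof.
move=> otT compG [b Bb] conB.
have [_ [[m Bm <-] mb] minm] := order_tree_min otT (imageP h Bb).
exists m => // x Bx; have [p [mpx _] pB] := conB m x Bm Bx.
have [z /pB Bz [zm zx]] := walk_lower_bound otT compG mpx.
by apply: le_trans zx; apply: minm (le_trans zm mb); exists z.
Qed.

Lemma chain_sub_branch A : is_chain A -> exists2 B, branch B & A `<=` B.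
Proof.
move=> chA.
(* Joining [A] to each set makes the empty union admissible. *)
have [F FP totF|B [chB maxB]] := @Zorn_bigcup T (fun X => is_chain (X `|` A)).
  move=> x y; case=> [[X FX Xx]|Ax]; case=> [[Y FY Yy]|Ay].
  - have [XY|YX] := totF _ _ FX FY.
      by apply: (FP Y FY); left=> //; apply: XY.
    by apply: (FP X FX); left=> //; apply: YX.
  - by apply: (FP X FX); [left|right].
  - by apply: (FP Y FY); [right|left].
  - exact: chA.
exists (B `|` A); last exact: subsetUr.
split=> // C chC BAC; apply/seteqP; split=> // x Cx.
apply: contrapT => nBAx; apply: (maxB C); last first.
  by rewrite (_ : C `|` A = C) //; apply/setUidPl => y Ay; apply: BAC; right.
split=> [y By|CB]; first by apply: BAC; left.
by apply: nBAx; left; apply: CB.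
Qed.

(* The level of [t] is indexed by the well-order of its predecessors.         *)
Lemma countable_below_eq (E : set T) : order_tree T ->
  (forall di (I : orderType di), well_order (<=%O : rel I) ->
     countable (level T I)) ->
  countable [set t | below t = E].
Proof.
move=> otT levT.
have [[t0 <-]|noE] := pselect (exists t0, below t0 = E); last first.
  rewrite (_ : mkset _ = set0) //.
  by rewrite -subset0 => t tE; apply: noE; exists t.
pose J : porderType d := sub_type {x : T | x < t0}.
have totJ : total (fun x y : J => x <= y).
  by move=> x y; apply: (order_tree_total otT (ltW (valP x)) (ltW (valP y))).
pose I : orderType d := HB.pack (Order.POrder.sort J)
  (Order.POrder.class J) (Order.POrder_isTotal.Build d J totJ).
have woI : well_order (<=%O : rel I).
  apply: antisymmetric_well_order => [|A [a Aa]]; first exact: le_anti.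
  have vaA : (val @` [set` A]) (val a) by exists a.
  have [_ [[m mA <-] ma] minm] := order_tree_min otT vaA.
  exists m; split=> // x Ax; have [xm|//] := orP (totJ x m).
  by apply: minm (le_trans xm ma); exists x.
apply: sub_countable (levT _ I woI); apply: subset_card_le => t /= tt0.
exists (val : I -> T) => //; rewrite tt0; apply/seteqP; split=> x.
  by case=> y _ <-; apply: (valP y).
by move=> xt; exists (exist _ x xt).
Qed.

End OrderTree.

(** * Countable filtrations and clubs in omega_1 *)

Lemma countable_setU (T : Type) (A B : set T) :
  countable A -> countable B -> countable (A `|` B).
Proof.
move=> cA cB.
have -> : A `|` B = \bigcup_(b in [set: bool]) (if b then A else B).
  apply/seteqP; split=> x; first by case=> ?; [exists true|exists false].
  by case=> -[] _ /=; [left|right].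
by apply: bigcup_countable; [exact: countableP|case].
Qed.

Lemma countable_inj_preimage (T U : Type) (h : T -> U) (B : set U) :
  injective h -> countable B -> countable (h @^-1` B).
Proof.
move=> inj_h /countable_injP[g inj_g]; apply/countable_injP; exists (g \o h).
move=> x y /set_mem hx /set_mem hy /inj_g gxy.
by apply/inj_h/gxy; exact: mem_set.
Qed.

Section Omega1.
Context d (W : orderType d).
Context (W_omega1 : is_omega1 W).

Lemma omega1_min (A : set W) :
  A !=set0 -> exists2 m, A m & forall x, A x -> m <= x.
Proof.
case: W_omega1 => woW _ _ [a Aa].
have [|m [[/set_mem Am minm] _]] := woW (mem A).
  by exists a; apply: mem_set.
by exists m => // x Ax; apply: minm; apply: mem_set.
Qed.

Lemma countable_bounded (E : set W) :
  countable E -> exists w, forall e, E e -> e < w.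
Proof.
case: W_omega1 => _ ncW cW cE; apply: contrapT => unbE; apply: ncW.
pose D := \bigcup_(e in E) ([set v | v < e] `|` [set e]).
apply: sub_countable (_ : countable D).
  apply: subset_card_le => w _; apply: contrapT => nw; apply: unbE.
  exists w => e Ee; rewrite ltNge; apply/negP; rewrite le_eqVlt => /predU1P we.
  by apply: nw; exists e => //; case: we; [right|left].
apply: bigcup_countable => // e _.
by apply: countable_setU => //; apply: countable1.
Qed.

Record filtration (X : Type) (K : W -> set X) : Prop := Filtration {
  filtration_mono : forall v w, v <= w -> K v `<=` K w;
  filtration_limit : forall s, limit_ordinal s ->
    forall x, K s x -> exists2 v, v < s & K v x;
  filtration_countable : forall w, countable (K w);
  filtration_cover : forall x, exists w, K w x
}.

Section Filtration.
Context (X : Type) (K : W -> set X).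
Context (filK : filtration K).

Lemma filtration_bound (E : set X) : countable E -> exists w, E `<=` K w.
Proof.
have [r Kr] := choice (filtration_cover filK) => cE.
have [|w ltw] := countable_bounded (sub_countable (card_image_le r E) _) => //.
exists w => x Ex; apply: filtration_mono (Kr x) => //.
by apply/ltW/ltw; exists x.
Qed.

Definition closed_under (c : X -> set X) : set W :=
  [set s | forall x, K s x -> c x `<=` K s].

(** Continuity of the filtration gives closedness. For unboundedness, absorb the values of [c] omega
    times; by continuity the supremum of the indices is closed under [c]. *)
Lemma club_closed_under (c : X -> set X) :
  (forall x, countable (c x)) -> club (closed_under c).
Proof.
move=> cc; split=> [s lims [_ cofs] x|w].
  move=> /(filtration_limit filK lims)[v vs Kvx].
  have [u [clu us] vu] := cofs v vs.
  apply: subset_trans (filtration_mono filK (ltW us)).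
  exact/clu/(filtration_mono filK vu).
have /choice[next nextP] v :
    exists v', v < v' /\ \bigcup_(x in K v) c x `<=` K v'.
  have [|v1 Kv1] := @filtration_bound (\bigcup_(x in K v) c x).
    by apply: bigcup_countable => //; apply: filtration_countable filK _.
  have [v2 v2P] := countable_bounded (countable1 v).
  exists (Order.max v1 v2); rewrite lt_max (v2P v) // orbT; split=> //.
  apply: subset_trans Kv1 _; apply: (filtration_mono filK).
  by rewrite le_max lexx.
pose u n := iter n next w.
have [|s us mins] := @omega1_min [set s | forall n, u n < s].
  have [|s us] := @countable_bounded (range u).
    by apply: sub_countable (card_image_le _ _) _; apply: countableP.
  by exists s => n; apply: us; exists n.
have cofs v : v < s -> exists n, v <= u n.
  move=> vs; apply: contrapT => nv; move: vs; rewrite ltNge => /negP; apply.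
  by apply: mins => n; rewrite ltNge; apply/negP => vn; apply: nv; exists n.
have lims : limit_ordinal s.
  split; first by exists (u 0).
  move=> v /cofs[n vn]; exists (u n.+1); last exact: us.
  by apply: le_lt_trans vn _; case: (nextP (u n)).
exists s; last exact: (ltW (us 0)).
move=> x /(filtration_limit filK lims)[v /cofs[n vn] Kvx].
apply: subset_trans (filtration_mono filK (ltW (us n.+1))).
case: (nextP (u n)) => _; apply: subset_trans => y cxy.
by exists x => //; apply: filtration_mono vn _ Kvx.
Qed.

End Filtration.
End Omega1.

Lemma infinite_image_inj (T U : Type) (h : T -> U) (A : set T) :
  injective h -> infinite_set A -> infinite_set (h @` A).
Proof.
move=> inj_h; apply: contra_not => finhA.
by rewrite (eq_finite_set (card_esym (inj_card_eq (in2W inj_h)))).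
Qed.

Lemma finite_below_Fin (X : eqType) (u : seq X) :
  finite_set [set x : sequence X | x <= Fin u].
Proof.
apply: sub_finite_set (_ : _ `<=` [set Fin (take n u) | n in `I_(size u).+1]) _.
  case=> [v|//] /=; rewrite le_sequence /= => vu; exists (size v).
    by rewrite /= ltnS; apply: size_prefix.
  by congr Fin; apply/eqP; rewrite -prefixE.
exact/finite_image/finite_II.
Qed.

Lemma lt_Inf (X : eqType) (x : sequence X) (g : nat -> X) :
  x < Inf g -> exists n, x = Fin (mkseq g n).
Proof.
case: x => [v|h]; rewrite lt_neqAle le_sequence /=.
  by case/andP=> _ /eqP vg; exists (size v); rewrite -vg.
by case/andP=> /eqP nhg /eqP hg; case: nhg; rewrite hg.
Qed.

Lemma cofinal_below_Inf (X : eqType) (g : nat -> X) (E : set (sequence X)) :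
  cofinal E (below (Inf g)) -> infinite_set E.
Proof.
have ltn n : Fin (mkseq g n) < Inf g.
  by rewrite lt_neqAle le_sequence /= size_mkseq eqxx andbT; apply/eqP.
apply: infinite_cofinal => [x y xg yg||x].
- exact/orP/(sequence_chain (ltW xg) (ltW yg)).
- by exists (Fin (mkseq g 0)); apply: ltn.
move=> /lt_Inf[n ->]; exists (Fin (mkseq g n.+1)); first exact: ltn.
rewrite lt_neqAle le_sequence mkseqS -cats1 /= prefix_prefix andbT.
apply/eqP => -[] /(congr1 size)/eqP.
by rewrite size_cat addn1 eqn_leq ltnn andbF.
Qed.

(** * Stages and their frontier *)

Section Subtree.
Context d (W : orderType d).
Context (W_omega1 : is_omega1 W).
Context (S : set W) (f : W -> nat -> W).
Context (f_cofinal : forall s, S s -> cofinal (range (f s)) [set v | v < s]).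

Lemma f_lt s n : S s -> f s n < s.
Proof. by case/f_cofinal=> ub _; apply: ub; exists n. Qed.

Lemma f_bound_le s w : S s -> (forall n, f s n < w) -> s <= w.
Proof.
case/f_cofinal=> _ cofs fw; rewrite leNgt; apply/negP => /cofs[_ [n _ <-]].
by rewrite leNgt fw.
Qed.

(** The strict [s < w] keeps [f s] out of stage [s], which contains all its proper initial
    segments. *)
Definition stage (w : W) : set (sequence W) := [set x |
  match x with
  | Fin u => all (fun v => v < w) u
  | Inf g => exists2 s, S s /\ s < w & g = f s
  end].

Lemma stage_lower w x y : x <= y -> stage w y -> stage w x.
Proof.
case: x y => [u|g] [u'|g']; rewrite le_sequence //=.
- by move=> /prefixP[v ->]; rewrite all_cat => /andP[].
- move=> /eqP -> [s [Ss sw] ->]; apply/allP => _ /mapP[n _ ->].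
  exact: lt_trans (f_lt n Ss) sw.
- by move=> /eqP ->.
Qed.

(** A cofinal sequence determines its supremum, so [f s] is not [f t] for a smaller [t] in [S]. *)
Lemma f_notin_stage s : S s -> ~ stage s (Inf (f s)).
Proof.
move=> Ss [t [St ts] fst]; have := ts; rewrite ltNge => /negP; apply.
by apply: f_bound_le => // n; rewrite fst; apply: f_lt.
Qed.

Lemma countable_stage w : countable (stage w).
Proof.
case: W_omega1 => _ _ cW.
have : countable (Fin @` [set u | all (fun v => v < w) u] `|`
                  (Inf \o f) @` [set v | v < w]).
  apply: countable_setU; apply: sub_countable (card_image_le _ _) _ => //.
  have /countable_injP[g inj_g] := cW w.
  apply/countable_injP; exists (fun u => pickle (map g u)) => u v.
  move=> /set_mem/= /allP uw /set_mem/= /allP vw.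
  move=> /(pcan_inj pickleK); elim: u v uw vw => [|a u IHu] [|b v] //= uw vw.
  case=> gab guv; congr cons.
    by apply: inj_g gab; apply/mem_set; [apply: uw|apply: vw]; apply: mem_head.
  by apply: IHu guv => x xs; [apply: uw|apply: vw]; rewrite inE xs orbT.
apply: sub_countable; apply: subset_card_le => -[u uw|g [s [Ss sw] ->]].
  by left; exists u.
by right; exists s.
Qed.

Lemma filtration_stage :
  filtration (fun w => [set x : subtree_on S f | stage w (\val x)]).
Proof.
split.
- move=> v w vw [[u|g] /= _] /=.
    by move=> /allP uv; apply/allP => x /uv/lt_le_trans; apply.
  by case=> s [Ss sv] ->; exists s => //; split=> //; apply: lt_le_trans sv vw.
- move=> s [[t0 t0s] lims] [[u|g] /= _] /=; last first.
    by case=> t [St /lims[v tv vs]] ->; exists v => //; exists t.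
  elim: u => [|a u IHu] /=; first by exists t0.
  case/andP=> /lims[v1 av1 v1s] /IHu[v2 v2s uv2].
  exists (Order.max v1 v2); first by rewrite gt_max v1s.
  rewrite lt_max av1 /=; apply/allP => x /(allP uv2) xv2.
  by rewrite lt_max xv2 orbT.
- by move=> w; apply: (countable_inj_preimage val_inj); apply: countable_stage.
- case=> [[u|g] /= xT].
    have cu := finite_set_countable (finite_seq u).
    have [w uw] := countable_bounded W_omega1 cu.
    by exists w => /=; apply/allP.
  case/set_mem: xT => [[]//|[s Ss [<-]]] /=.
  have [w sw] := countable_bounded W_omega1 (countable1 s).
  by exists w => /=; exists s => //; split=> //; apply: sw.
Qed.

(* A vertex outside a stage with infinitely many comparable vertices in it    *)
(* has infinitely many prefixes there, so all its entries are below [w].      *)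
Lemma stage_frontier w x (E : set (sequence W)) :
  infinite_set E -> E `<=` stage w -> (forall e, E e -> e >=< x) ->
  subtree_on S f x -> ~ stage w x -> S w /\ x = Inf (f w).
Proof.
move=> infE Ew Ex xT nwx.
have {}Ex e : E e -> e <= x.
  move=> Ee; have [//|xe] := orP (Ex e Ee).
  by case: nwx; apply: stage_lower xe (Ew e Ee).
case: xT Ex nwx => [[u _ <-]|[s Ss <-]] Ex nwx.
  by case: infE; apply: sub_finite_set (finite_below_Fin u).
suff fw n : f s n < w.
  have := f_bound_le Ss fw; rewrite le_eqVlt => /predU1P[<-//|sw].
  by case: nwx; exists s.
(* If entry [n] is not below [w], only initial segments of length at most [n] can lie in the
   stage. *)
apply: contrapT => nfw; apply: infE.
apply: sub_finite_set (finite_below_Fin (mkseq (f s) n)) => e Ee /=.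
have := Ex _ Ee; have := Ew _ Ee; case: e Ee => [u|g] Ee.
  rewrite !le_sequence /= => uw /eqP us; rewrite us in uw *.
  have [nu|un] := ltnP n (size u).
    by case: nfw; apply: (allP uw); apply/mapP; exists n; rewrite ?mem_iota.
  apply/prefixP; exists (map (f s) (iota (size u) (n - size u))).
  by rewrite /mkseq -map_cat -[X in _ ++ iota X _]add0n -iotaD subnKC.
rewrite le_sequence /= => /[swap] /eqP -> [t [St tw] fst].
by case: nwx; exists t.
Qed.

End Subtree.

(** * Normal spanning trees and minors *)

Section Obstructions.
Context d (W : orderType d) (W_omega1 : is_omega1 W) (S : set W).
Context (G : graph (sequence W)) (G_T : T_graph G) (f : W -> nat -> W).
Context (f_cofinal : forall s, S s -> cofinal (range (f s)) [set v | v < s]).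

Local Notation X := (subtree_on S f).
Local Notation GS := (induced G X).
Local Notation K := (fun w => [set x : X | stage S f w (\val x)]).

Let filK : filtration K := filtration_stage W_omega1 S f.

Lemma no_normal_spanning_tree : stationary S -> ~ has_normal_spanning_tree GS.
Proof.
move=> statS [R [r [[_ acR] _ normalR]]].
have ctree x : countable [set y | tree_le R r y x].
  exact/finite_set_countable/finite_tree_le.
have [s [Ss closed_s]] := statS _ (club_closed_under W_omega1 filK ctree).
have xX : Inf (f s) \in X by apply: mem_set; right; exists s.
pose x : X := exist _ (Inf (f s)) xX.
have : infinite_set [set y | GS x y /\ \val y < Inf (f s)].
  apply: contra_not (cofinal_below_Inf (G_T.2 (Inf (f s)))).
  move=> /(finite_image (fun y : X => \val y)); apply: sub_finite_set.
  move=> u [xu us]; have uX : u \in X.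
    by apply: mem_set; left; have [n ->] := lt_Inf us; exists (mkseq (f s) n).
  by exists (exist _ u uX).
apply; apply: sub_finite_set (finite_tree_le r x acR) => y [xy ys].
(* If [x] were below [y] in the tree, closure of stage [s] would put [f s] into it. *)
case: (normalR _ _ xy) => // xley; case: (f_notin_stage f_cofinal Ss).
suff Ky : K s y by apply: (closed_s _ Ky x).
have [n /= ->] := lt_Inf ys; apply/allP => _ /mapP[k _ ->].
exact: (f_lt f_cofinal).
Qed.

(* Branch sets are represented by their minima in the sequence tree.          *)
Lemma minor_comparable_injection (U : Type) (H : graph U) : minor H GS ->
  exists2 m : U -> X, injective m &
    forall x y, H x y -> \val (m x) >=< \val (m y).
Proof.
case=> B [Bcon trivB Badj].
have compG (u v : X) : GS u v -> \val u >=< \val v by apply: G_T.1.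
have /choice[m mP] x : exists m, B x m /\ forall u, B x u -> \val m <= \val u.
  have [Bx0 conB] := Bcon x.
  have [m Bm minm] := connected_set_min (sequence_order_tree W) compG Bx0 conB.
  by exists m.
exists m => [x y mxy|x y /Badj[u [v [Bu Bv /compG uv]]]].
  apply: trivB => //; exists (m x); split; first by case: (mP x).
  by rewrite mxy; case: (mP y).
have mu := (mP x).2 _ Bu; have mv := (mP y).2 _ Bv.
(* Both minima lie below the larger of [u] and [v]. *)
have [uv'|vu] := orP uv; apply: sequence_chain.
- exact: le_trans mu uv'.
- exact: mv.
- exact: mu.
- exact: le_trans mv vu.
Qed.

Lemma no_aleph0_aleph1_minor (U : Type) (H : graph U) :
  aleph0_aleph1_graph W H -> ~ minor H GS.
Proof.
case: (W_omega1) => _ ncW _ [A [B [[_ AB0] bip cA cB infB]]].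
case/minor_comparable_injection=> m inj_m compm.
have cmA : countable (m @` A).
  by apply: sub_countable (card_image_le _ _) _; rewrite (eq_countable cA).
have [w Aw] := filtration_bound W_omega1 filK cmA.
apply: ncW; rewrite -(eq_countable cB).
have : countable (K w `|` [set x | \val x = Inf (f w)]).
  apply: countable_setU; first exact: (filtration_countable filK).
  exact: (countable_inj_preimage val_inj) (countable1 (Inf (f w))).
move=> /(countable_inj_preimage inj_m); apply: sub_countable.
apply: subset_card_le => b Bb /=.
have [//|nbw] := pselect (K w (m b)); [by left|right].
pose E := (fun a => \val (m a)) @` [set a | H b a].
have infE : infinite_set E.
  by apply: infinite_image_inj (infB b Bb) => a a' /val_inj/inj_m.
apply: (stage_frontier f_cofinal infE _ _ (set_valP (m b)) nbw).2.
  move=> _ [a Hba <-]; apply: (Aw (m a)); exists a => //.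
  case: (bip _ _ Hba) => -[Ab Ba] //.
  have : (A `&` B) b by []; by rewrite AB0.
by move=> _ [a /compm + <-]; rewrite comparable_sym.
Qed.

Section AronszajnMinor.
Context dT (T : porderType dT) (H : graph T).
Context (T_aronszajn : aronszajn_tree W T).
Context (H_lower : cofinal_lower_neighbours H).
Context (m : T -> X) (inj_m : injective m).
Context (m_comparable : forall t u, H t u -> \val (m t) >=< \val (m u)).

Let T_tree : order_tree T. Proof. by case: T_aronszajn. Qed.

Lemma aronszajn_chain_countable (A : set T) : is_chain A -> countable A.
Proof.
case: T_aronszajn => _ _ _ cbr /chain_sub_branch[B /cbr cB AB].
exact: sub_countable (subset_card_le AB) cB.
Qed.

Lemma aronszajn_below_eq_countable (E : set T) :
  countable [set t | below t = E].
Proof. by case: T_aronszajn => otT _ clev _; apply: countable_below_eq. Qed.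

Lemma downset_chain (t : T) : is_chain [set u | u <= t].
Proof. by move=> u v ut vt; apply/orP/(order_tree_total T_tree ut vt). Qed.

(* A stage closed under this function traces on [T] a down-closed set that    *)
(* contains the root and all immediate successors of its elements.            *)
Definition tree_closure (x : X) : set X :=
  m @` ([set t | below t = set0] `|`
    [set t | exists2 u, m u = x & t <= u \/ below t = [set v | v <= u]]).

Lemma countable_tree_closure x : countable (tree_closure x).
Proof.
apply: sub_countable (card_image_le _ _) _; apply: countable_setU.
  exact: aronszajn_below_eq_countable.
have [[u <-]|nx] := pselect (exists u, m u = x); last first.
  apply: sub_countable (countable0 T); apply: subset_card_le => t [u ux _].
  by apply: nx; exists u.
have : countable ([set t | t <= u] `|` [set t | below t = [set v | v <= u]]).
  apply: countable_setU; last exact: aronszajn_below_eq_countable.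
  exact/aronszajn_chain_countable/downset_chain.
apply: sub_countable; apply: subset_card_le => t [v /inj_m ->].
by case; [left|right].
Qed.

Local Notation C := (closed_under K tree_closure).

Definition first_outside (w : W) (t : T) : Prop :=
  ~ K w (m t) /\ forall u, u < t -> K w (m u).

Lemma first_outsideP w t : ~ K w (m t) -> exists2 u, first_outside w u & u <= t.
Proof.
pose A := [set t | ~ K w (m t)]; move=> nwt.
have [u [nwu ut] minu] := order_tree_min (A := A) T_tree nwt.
exists u => //; split=> // v vu; apply: contrapT => nwv.
have uv := minu v nwv (le_trans (ltW vu) ut).
by have := lt_le_trans vu uv; rewrite ltxx.
Qed.

Lemma first_outside_ex w : exists t, first_outside w t.
Proof.
case: (W_omega1) T_aronszajn => _ ncW _ [_ cT _ _].
have [[t nwt]|all_in] := pselect (exists t, ~ K w (m t)).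
  by have [u uw _] := first_outsideP nwt; exists u.
case: ncW; rewrite -(eq_countable cT).
have := countable_inj_preimage inj_m (filtration_countable filK w).
apply: sub_countable; apply: subset_card_le => t _.
by apply: contrapT => nwt; apply: all_in; exists t.
Qed.

(** Closure rules out that [t] is the root or has a last predecessor, so its lower neighbours are
    infinitely many, all mapped into the stage. *)
Lemma first_outside_frontier w t : C w -> first_outside w t ->
  \val (m t) = Inf (f w).
Proof.
move=> Cw [nwt wt]; pose N := [set u | H t u /\ u < t].
have infN : infinite_set N.
  apply: infinite_cofinal (H_lower t).
  - move=> u v /ltW ut /ltW vt; exact: downset_chain ut vt.
  - apply: contrapT => /nonemptyPn t0.
    (* The empty sequence is in every stage, and [tree_closure] of any vertex contains the image of
       the root. *)
    have rX : Fin [::] \in X by apply: mem_set; left; exists [::].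
    apply: nwt; apply: (Cw (exist _ (Fin [::]) rX)) => //.
    by exists t => //; left.
  - move=> u ut; apply: contrapT => nv; apply: nwt; apply: (Cw _ (wt u ut)).
    exists t => //; right; exists u => //; right; apply/seteqP; split=> v.
      move=> vt; have [//|] := orP (order_tree_total T_tree (ltW vt) (ltW ut)).
      by rewrite le_eqVlt => /predU1P[<- /=|uv] //; case: nv; exists v.
    by move=> vu; apply: le_lt_trans vu ut.
pose E := (fun u => \val (m u)) @` N.
have infE : infinite_set E.
  by apply: infinite_image_inj infN => u v /val_inj/inj_m.
apply: (stage_frontier f_cofinal infE _ _ (set_valP (m t)) nwt).2.
  by move=> _ [u [_ /wt wu] <-].
by move=> _ [u [/m_comparable + _] <-]; rewrite comparable_sym.
Qed.

(** For [v <= w], some first node outside stage [v] lies below [u]; it shares the image [f v] with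
    [t], so it is [t]. *)
Lemma first_outside_chain :
  is_chain [set t | exists2 w, C w & first_outside w t].
Proof.
have le_first v w t u : C v -> first_outside v t -> first_outside w u ->
    v <= w -> t <= u.
  move=> Cv vt [nwu _] vw.
  have [|t' vt' t'u] := @first_outsideP v u.
    by apply: contra_not nwu; apply: (filtration_mono filK).
  suff -> : t = t' by [].
  by apply/inj_m/val_inj; rewrite !(first_outside_frontier Cv).
move=> t u [v Cv vt] [w Cw wu]; have [vw|wv] := orP (le_total v w).
  by left; apply: le_first vw.
by right; apply: le_first wv.
Qed.

(** The chain of first exits is countable, so one stage contains its image; yet a later closed stage
    has a first exit too. *)
Lemma aronszajn_contradiction : False.
Proof.
have cF := aronszajn_chain_countable first_outside_chain.
have cmF := sub_countable (card_image_le m _) cF.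
have [w Fw] := filtration_bound W_omega1 filK cmF.
have [_ unbC] := club_closed_under W_omega1 filK countable_tree_closure.
have [v Cv wv] := unbC w.
have [t vt] := first_outside_ex v; case: (vt) => + _; apply.
apply: (filtration_mono filK wv); apply: Fw; exists t => //.
by exists v.
Qed.

End AronszajnMinor.

Lemma no_aronszajn_tree_minor dT (T : porderType dT) (H : graph T) :
  aronszajn_tree_graph W H -> ~ minor H GS.
Proof.
case=> arT lowH /minor_comparable_injection[m inj_m compm].
exact (aronszajn_contradiction arT lowH inj_m compm).
Qed.

End Obstructions.

Theorem theorem3p1 (d : Order.disp_t) (W : orderType d) (hW : is_omega1 W)
    (S : set W) (hS : stationary S)
    (hlim : forall s, S s -> limit_ordinal s)
    (G : graph (sequence W)) (hG : T_graph G)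
    (f : W -> nat -> W)
    (hf : forall s, S s -> cofinal (range (f s)) [set v | v < s]) :
  [/\ ~ has_normal_spanning_tree (induced G (subtree_on S f)),
      ~ (exists (V : Type) (H : graph V),
           aleph0_aleph1_graph W H /\ minor H (induced G (subtree_on S f))) &
      ~ (exists (dT : Order.disp_t) (T : porderType dT) (H : graph T),
           aronszajn_tree_graph W H /\ minor H (induced G (subtree_on S f)))].
Proof.
split; first exact: no_normal_spanning_tree.
  by move=> [V [H [HA minH]]]; apply: no_aleph0_aleph1_minor minH.
by move=> [dT [T [H [HA minH]]]]; apply: no_aronszajn_tree_minor minH.
Qed.
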